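(* Consider the cascade model with $N$ processors, rates $\lambda_1,\dots,\lambda_N>0$ that are pairwise distinct, and $\beta_{j,j+1}>0$ ($j=1,\dots,N-1$), started from a fixed initial state. Let $\ell(m)=\min_{i\le m}\lambda_i$ and let $\{1,\dots,N\}=G_1\cup\dots\cup G_K$ be the partition into groups, where the groups are the maximal sets of consecutive indices on which $\ell$ is constant. If $|G_k|\le 3$ for all $k$, then for every $j$ the limit $v^*_j=\lim_{t\to\infty}x_j(t)/t$ exists in probability and $v^*_j=\ell(j)$.
   Context: Cascade model with parameters $(\lambda_1,\dots,\lambda_N;\beta_{12},\dots,\beta_{N-1,N})$: a continuous-time process $X(t)=(x_1(t),\dots,x_N(t))\in\mathbb Z^N$. Mutually independent Poisson flows: $\Pi^k$ of intensity $\lambda_k$ for each $k$, and $\Pi^{k,k+1}$ of intensity $\beta_{k,k+1}$ for $k=1,\dots,N-1$. At each point of $\Pi^k$, $x_k$ increases by $1$. At each point $\sigma$ of $\Pi^{k,k+1}$, processor $k$ sends processor $k+1$ a message carrying $x_k(\sigma)$, arriving instantly; if $x_{k+1}(\sigma)>x_k(\sigma)$ then $x_{k+1}(\sigma+0)=x_k(\sigma)$ (rollback). Whenever a processor $l$ is rolled back at time $\sigma$ to value $x$, all messages sent by $l$ during $(\theta,\sigma)$, with $\theta=\max\{s\le\sigma:x_l(s)=x,\ x_l(s+0)=x+1\}$, are cancelled; if the recipient $q=l+1$ of a cancelled message sent at time $s'$ has current local time larger than $x_l(s')$, then $x_q$ is rolled back to $x_l(s')$ and its messages are cancelled likewise,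 and so on (cascading rollback). Since $\ell$ is nonincreasing, its level sets are intervals of consecutive indices: there are $1=j_1<j_2<\dots<j_K<j_{K+1}=N+1$ with $G_k=\{j_k,\dots,j_{k+1}-1\}$ and $\ell(j_k)=\dots=\ell(j_{k+1}-1)$, $\ell(j_k-1)>\ell(j_k)$, $\ell(j_{k+1}-1)>\lambda_{j_{k+1}}$. *)

(* Defs.v *)
From HB Require Import structures.
From mathcomp Require Import all_boot all_order all_algebra.
From mathcomp Require Import all_classical all_reals all_analysis.
Set Implicit Arguments. Unset Strict Implicit. Unset Printing Implicit Defensive.
Import Order.TTheory GRing.Theory Num.Theory.
Local Open Scope ring_scope.
Local Open Scope classical_set_scope.

(* Processors are indexed 0..N-1 (paper: 1..N).
   Poisson flows: inl k = Pi^k (local step of processor k, k < N),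
                  inr k = Pi^{k,k+1} (message from k to k+1, k < N-1). *)
Definition flow (N : nat) := ('I_N + 'I_N.-1)%type.

Definition flow_rate (R : Type) (N : nat) (lam beta : nat -> R) (f : flow N) : R :=
  match f with inl k => lam k | inr k => beta k end.

(* State of the cascade model:
   xs k   = local time x_k,
   hist k = list of local increments of processor k, as (time s, value x with
            x_k(s) = x, x_k(s+0) = x+1), most recent first,
   sent k = list of not (yet) cancelled messages sent by k to k+1, as
            (sending time, carried value), most recent first. *)
Record cstate (R : Type) := CState {
  xs : nat -> int ;
  hist : nat -> seq (R * int) ;
  sent : nat -> seq (R * int) }.

Definition upd (T : Type) (f : nat -> T) (k : nat) (v : T) : nat -> T :=
  fun i => if i == k then v else f i.

Section Cascade.
Variable R : realType.
Variable N : nat.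

(* theta = max{ s : x_l(s) = v, x_l(s+0) = v+1 }; 0 (i.e. before all events)
   if there is no such s. *)
Definition last_incr_time (h : seq (R * int)) (v : int) : R :=
  match [seq p <- h | p.2 == v] with (t, _) :: _ => t | [::] => 0 end.

(* Processor l is rolled back at time sg to value v; its messages sent during
   (theta, sg) are cancelled, and the recipient l+1 is rolled back (cascade) to
   the smallest carried value of the cancelled messages, if that is smaller
   than its current local time.  The fuel N bounds the cascade length. *)
Fixpoint rollback (fuel : nat) (l : nat) (v : int) (sg : R) (s : cstate R)
  : cstate R :=
  let th := last_incr_time (hist s l) v in
  let canc := [seq m <- sent s l | (th < m.1) && (m.1 < sg)] in
  let keep := [seq m <- sent s l | ~~ ((th < m.1) && (m.1 < sg))] in
  let s1 := CState (upd (xs s) l v) (hist s) (upd (sent s) l keep) in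
  match fuel with
  | 0 => s1
  | fuel'.+1 =>
      let w := foldr (fun m acc => Order.min m.2 acc) (xs s1 l.+1) canc in
      if (l.+1 < N)%N && (w < xs s1 l.+1)
      then rollback fuel' l.+1 w sg s1 else s1
  end.

Definition step (f : flow N) (sg : R) (s : cstate R) : cstate R :=
  match f with
  | inl k => CState (upd (xs s) k (xs s k + 1))
                    (upd (hist s) k ((sg, xs s k) :: hist s k)) (sent s)
  | inr k =>
      let s1 := CState (xs s) (hist s) (upd (sent s) k ((sg, xs s k) :: sent s k)) in
      if xs s k < xs s k.+1 then rollback N k.+1 (xs s k) sg s1 else s1
  end.

(* n-th point (n >= 0) of flow f, given the inter-arrival times E f 0, E f 1, ... *)
Definition arrival (E : flow N -> nat -> R) (f : flow N) (n : nat) : R :=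
  \sum_(i < n.+1) E f i.

(* Jump chain: state after processing the first k points of the superposition
   of all flows (in time order), the number of processed points of each flow,
   and the time of the k-th point (0 for k = 0). *)
Fixpoint chain (x0 : nat -> int) (E : flow N -> nat -> R) (k : nat)
  : cstate R * (flow N -> nat) * R :=
  match k with
  | 0 => (CState x0 (fun _ => [::]) (fun _ => [::]), (fun _ => 0%N), 0)
  | k'.+1 =>
      let: (s, idx, t) := chain x0 E k' in
      match [pick f | [forall g, arrival E f (idx f) <= arrival E g (idx g)]] with
      | Some f => (step f (arrival E f (idx f)) s,
                   (fun g => if g == f then (idx g).+1 else idx g),
                   arrival E f (idx f))
      | None => (s, idx, t)
      end
  end.

Definition event_time x0 E k := (chain x0 E k).2.
Definition config x0 E k := (chain x0 E k).1.1.

Definition position_at (x0 : nat -> int) (E : flow N -> nat -> R) (t : R)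
  (j : nat) (v : int) : Prop :=
  exists k, event_time x0 E k <= t < event_time x0 E k.+1 /\
            xs (config x0 E k) j = v.

End Cascade.

Definition ell (R : realType) (lam : nat -> R) (m : nat) : R :=
  \big[Order.min/lam 0%N]_(i < m.+1) lam i.

Section Prob.
Context {d : measure_display} {Omega : measurableType d} {R : realType}
  (P : probability Omega R).

Definition mutually_independent (I : eqType) (X : I -> Omega -> R) : Prop :=
  forall (s : seq I) (B : I -> set R), uniq s -> (forall i, measurable (B i)) ->
  P (\big[setI/setT]_(i <- s) (X i @^-1` B i)) =
  (\prod_(i <- s) P (X i @^-1` B i))%E.

Definition exponential_rv (a : R) (X : Omega -> R) : Prop :=
  forall t, 0 <= t -> P [set w | t < X w] = (expR (- (a * t)))%:E.
End Prob.

(* Main.v *)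
(** Cascading rollbacks never bring a processor below the value carried by the
    message that started them: the messages cancelled when processor [l] returns
    to [v] were all sent after its last passage through [v], hence carry values
    above [v].  So every rollback of [j] leaves [x_j >= x_i] for some [i < j], and
    since [x_j] otherwise grows at rate [lam j], induction on the events gives
    [x_j(t) >= ell(j) t - o(t)] as soon as all Poisson flows run at their nominal
    rates up to [o(t)].  Conversely [x_j <= x_j(0) + Pi^j], and a message from
    [j-1] to [j] arrives every [o(t)] time units, so [x_j <= x_{j-1} + o(t)].
    Uniform control of the flows up to time [t] comes from Chebyshev's inequality
    for the arrival times at finitely many indices and monotonicity in between. *)
Require Import Defs.
From HB Require Import structures.
From mathcomp Require Import all_boot all_order all_algebra.
From mathcomp Require Import all_classical all_reals all_analysis.
From mathcomp Require Import measurable_realfun.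
From mathcomp Require Import zify ring lra.
Set Implicit Arguments. Unset Strict Implicit. Unset Printing Implicit Defensive.
Import Order.TTheory GRing.Theory Num.Theory.
Local Open Scope classical_set_scope.
Local Open Scope ring_scope.

(** * Pathwise bounds *)

Section Rollback.
Variables (R : realType) (N : nat).
Implicit Types (s : cstate R) (sg : R) (v w : int).

(* After the last passage [v -> v+1] a processor stays above [v], hence so do
   the messages sent since then. *)
Definition sent_above_passages s : Prop :=
  forall l v m, v < xs s l -> m \in sent s l ->
    last_incr_time (hist s l) v < m.1 -> v <= m.2.

(** Guarantees that a local step made at [sg] is not strictly earlier than any stored message. *)
Definition events_before sg s : Prop :=
  forall l m, m \in sent s l -> m.1 <= sg.

Lemma foldr_min_ge v w (c : seq (R * int)) : v <= w ->
  (forall m, m \in c -> v <= m.2) ->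
  v <= foldr (fun m acc => Order.min m.2 acc) w c.
Proof.
move=> vw; elim: c => //= m c IH H; rewrite le_min H ?mem_head//=.
by apply: IH => m' m'c; apply: H; rewrite inE m'c orbT.
Qed.

(** One level of [rollback], before the cascade goes on to [l.+1]. *)
Definition truncate l v sg s : cstate R :=
  let th := last_incr_time (hist s l) v in
  CState (upd (xs s) l v) (hist s)
    (upd (sent s) l [seq m <- sent s l | ~~ ((th < m.1) && (m.1 < sg))]).

(** Truncation lowers one local time, deletes messages and keeps the history, so both invariants are
    only tested on fewer cases. *)
Lemma truncate_spec l v sg s : v < xs s l ->
  sent_above_passages s -> events_before sg s ->
  let s' := truncate l v sg s in
  [/\ sent_above_passages s', events_before sg s',
      (forall i, (i < l)%N -> xs s' i = xs s i) /\ xs s' l = v,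
      (forall i, xs s' i <= xs s i) &
      (forall i, Order.min v (xs s i) <= xs s' i)].
Proof.
move=> vl Is Bs; split.
- move=> i u m /=; rewrite /upd; case: eqP => [->|_]; last exact: Is.
  by move=> uv; rewrite mem_filter => /andP[_]; apply: Is; exact: lt_trans uv vl.
- move=> i m /=; rewrite /upd; case: eqP => _; last exact: Bs.
  by rewrite mem_filter => /andP[_]; exact: Bs.
- by split=> [i il /=|/=]; rewrite /upd ?eqxx// ltn_eqF.
- by move=> i /=; rewrite /upd; case: (i =P l) => [->|//]; exact: ltW.
- by move=> i /=; rewrite /upd; case: (i =P l) => _; rewrite ge_min lexx ?orbT.
Qed.

(** The cascade only moves to higher indices, and its next target [w] is again at least [v]; hence
    no processor falls below [v] unless it was there already. *)
Lemma rollback_spec fuel l v sg s : v < xs s l ->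
  sent_above_passages s -> events_before sg s ->
  let s' := rollback N fuel l v sg s in
  [/\ sent_above_passages s', events_before sg s',
      (forall i, (i < l)%N -> xs s' i = xs s i) /\ xs s' l = v,
      (forall i, xs s' i <= xs s i) &
      (forall i, Order.min v (xs s i) <= xs s' i)].
Proof.
elim: fuel l v s => [|fuel IH] l v s vl Is Bs; first exact: truncate_spec.
have [Is1 Bs1 [P1 P2] P3 P4] := truncate_spec vl Is Bs.
rewrite /= -/(truncate l v sg s); set s1 := truncate l v sg s.
set canc := [seq m <- sent s l | _].
set w := foldr _ _ _.
case: ifP => [/andP[lN wl]|_]; last by split.
(* Cancelled messages were sent after the last passage through [v], so they carry at least [v]; and
   [w] is strictly below the recipient's local time, so [w] is one of the carried values. *)
have vw : v <= w.
  have : Order.min v (xs s1 l.+1) <= w.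
    apply: foldr_min_ge; first by rewrite ge_min lexx orbT.
    move=> m; rewrite mem_filter => /andP[/andP[th _] ml].
    by rewrite ge_min (Is _ _ _ vl ml th).
  by rewrite ge_min => /orP[//|]; rewrite leNgt wl.
have [Q1 Q2 [Q3 Q4] Q5 Q6] := IH l.+1 w s1 wl Is1 Bs1.
split => //.
- split; last by rewrite Q3.
  by move=> i il; rewrite Q3 ?P1//; exact: ltnW.
- by move=> i; apply: le_trans (P3 i).
- move=> i; apply: le_trans (Q6 i); rewrite le_min P4 andbT.
  by rewrite ge_min vw.
Qed.

Lemma step_local k sg s : sent_above_passages s -> events_before sg s ->
  let s' := step (inl k : flow N) sg s in
  [/\ sent_above_passages s', events_before sg s',
      xs s' k = xs s k + 1 & forall i, i != k :> nat -> xs s' i = xs s i].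
Proof.
move=> Is Bs; split => /=.
- move=> l v m /=; rewrite /upd; case: eqP => [->|_]; last exact: Is.
  move=> vx ml; rewrite /last_incr_time/=.
  (* If [v] is the value just left, its last passage is [sg] and no stored message is later; for
     smaller [v] the last passage is unchanged. *)
  case: eqP => [xv /(le_lt_trans (Bs _ _ ml))|/eqP xv]; first by rewrite ltxx.
  by apply: Is => //; lia.
- exact: Bs.
- by rewrite /upd eqxx.
- by move=> i /negbTE ik; rewrite /upd ik.
Qed.

Lemma step_message k sg s : sent_above_passages s -> events_before sg s ->
  let s' := step (inr k : flow N) sg s in
  [/\ sent_above_passages s', events_before sg s',
      (forall i, (i <= k)%N -> xs s' i = xs s i) /\ xs s' k.+1 <= xs s k,
      (forall i, xs s' i <= xs s i) &
      (forall i, Order.min (xs s k) (xs s i) <= xs s' i)].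
Proof.
move=> Is Bs /=; set s1 := CState _ _ _.
have Is1 : sent_above_passages s1.
  move=> l v m /=; rewrite /upd; case: eqP => [->|_]; last exact: Is.
  move=> vx; rewrite inE => /predU1P[-> _|]; first exact: ltW.
  exact: Is.
have Bs1 : events_before sg s1.
  move=> l m /=; rewrite /upd; case: eqP => _; last exact: Bs.
  by rewrite inE => /predU1P[->//|]; exact: Bs.
case: ifP => [xk|/negbT]; last first.
  rewrite -leNgt => xk; split => // i.
  by rewrite ge_min lexx orbT.
have [Q1 Q2 [Q3 Q4] Q5 Q6] := @rollback_spec N k.+1 (xs s k) sg s1 xk Is1 Bs1.
by split => //; split; [exact: Q3|rewrite Q4].
Qed.

End Rollback.

(** * Running minima of the rates *)

Section Ell.
Variables (R : realType) (lam : nat -> R).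

Lemma le_ellP x m :
  reflect (forall i, (i <= m)%N -> x <= lam i) (x <= ell lam m).
Proof.
apply: (iffP (bigmin_geP _ _ _ _)) => [[_ H] i im|H].
  by have := H (Ordinal (im : (i < m.+1)%N)) isT.
by split=> [|i _]; apply: H; rewrite // -ltnS.
Qed.

Lemma ell_le m i : (i <= m)%N -> ell lam m <= lam i.
Proof. by move: i; apply/le_ellP. Qed.

Lemma ellS m : ell lam m.+1 = Order.min (ell lam m) (lam m.+1).
Proof.
apply/le_anti/andP; split.
  rewrite le_min ell_le// andbT; apply/le_ellP => i im.
  by apply: ell_le; exact: leqW.
apply/le_ellP => i; rewrite leq_eqVlt ltnS => /predU1P[->|im].
  by rewrite ge_min lexx orbT.
by rewrite ge_min ell_le.
Qed.

Lemma ell0 : ell lam 0 = lam 0.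
Proof. by rewrite /ell big_ord_recl big_ord0 minxx. Qed.

Lemma ell_anti m n : (m <= n)%N -> ell lam n <= ell lam m.
Proof. by move=> mn; apply/le_ellP => i im; apply: ell_le; exact: leq_trans im mn. Qed.

End Ell.

(** * Event times, point counts and increments along the jump chain *)

Section JumpChain.
Variables (R : realType) (N : nat) (x0 : nat -> int) (E : flow N -> nat -> R).
Hypothesis N_gt0 : (0 < N)%N.

(** The Poisson counts, read at the event times. *)
Definition processed k : flow N -> nat := (chain x0 E k).1.2.
Local Notation S := (config x0 E).
Local Notation T := (event_time x0 E).
Local Notation I := processed.

(** Shifted by one from [arrival]: [wait_sum f n] is the time of the [n]-th point, and [0] for
    [n = 0]. *)
Definition wait_sum (f : flow N) n : R := \sum_(i < n) E f i.

(** The set of flows is finite and, as [N > 0], nonempty, so an earliest pending point exists and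
    the [None] branch of [chain] is never taken. *)
Lemma chainS k : exists f, [/\ T k.+1 = wait_sum f (I k f).+1,
  forall g, T k.+1 <= wait_sum g (I k g).+1,
  I k.+1 = (fun g => if g == f then (I k g).+1 else I k g) &
  S k.+1 = step f (T k.+1) (S k)].
Proof.
rewrite /event_time /config /processed /=.
case: (chain x0 E k) => [[s idx] t] /=.
case: pickP => [f /forallP fmin|none]; first by exists f; split.
have /= := none [arg min_(f < inl (Ordinal N_gt0) : flow N) arrival E f (idx f)]%O.
by case: arg_minP => //= f _ fmin /negP[]; apply/forallP => g; exact: fmin.
Qed.

Hypothesis E_ge0 : forall f n, 0 <= E f n.

Lemma wait_sumS f n : wait_sum f n.+1 = wait_sum f n + E f n.
Proof. by rewrite /wait_sum big_ord_recr. Qed.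

Lemma wait_sum_mono f m n : (m <= n)%N -> wait_sum f m <= wait_sum f n.
Proof.
move/subnK <-; elim: (n - m)%N => //= k IH.
by rewrite addSn wait_sumS; apply: le_trans IH _; rewrite lerDl.
Qed.

(** The next event is the earliest pending point: the flow that moves gets [T k.+1] as its new lower
    end, and the pending points of the others are not earlier. *)
Lemma processed_time k f :
  wait_sum f (I k f) <= T k <= wait_sum f (I k f).+1.
Proof.
elim: k f => [|k IH] f; first by rewrite /event_time/= /wait_sum big_ord0 big_ord1 lexx E_ge0.
have [g [Tg Tle -> _]] := chainS k.
case: eqP => [->|_]; first by rewrite Tg lexx wait_sum_mono.
rewrite Tle andbT; have /andP[/le_trans -> //] := IH f.
by rewrite Tg; have /andP[] := IH g.
Qed.

Lemma event_time_leS k : T k <= T k.+1.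
Proof.
have [g [-> _ _ _]] := chainS k; by have /andP[] := processed_time k g.
Qed.

Lemma event_time_mono k k' : (k <= k')%N -> T k <= T k'.
Proof.
move/subnK <-; elim: (k' - k)%N => //= m IH.
by rewrite addSn; apply: le_trans IH (event_time_leS _).
Qed.

Lemma event_time_ge0 k : 0 <= T k.
Proof. exact: (@event_time_mono 0). Qed.

(** Each event consumes one point; by pigeonhole, many events force some flow to have advanced
    far. *)
Lemma processed_sum k : (\sum_f I k f)%N = k.
Proof.
elim: k => [|k IH]; first by rewrite big1.
have [g [_ _ -> _]] := chainS k.
rewrite -[in RHS]IH (bigD1 g)//= eqxx [in RHS](bigD1 g)//=.
by rewrite addSn; congr (_ + _).+1; apply: eq_bigr => f /negbTE ->.
Qed.

Lemma config_inv k : sent_above_passages (S k) /\ events_before (T k) (S k).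
Proof.
elim: k => [|k [IH1 IH2]]; first by [].
have [f [_ _ _ ->]] := chainS k.
have B : events_before (T k.+1) (S k).
  by move=> l m /IH2 /le_trans; apply; exact: event_time_leS.
by case: f => i; [have [] := step_local i IH1 B|have [] := step_message i IH1 B].
Qed.

(** All that the bounds on local times see of an event: exact growth for a local step, and for a
    message from [i] a drop limited by the value of [i]. *)
Variant chain_move k : Prop :=
| ChainLocal (i : 'I_N) of
    (forall f, I k.+1 f = ((f == inl i) + I k f)%N) &
    (forall j, xs (S k.+1) j = xs (S k) j + (j == i :> nat)%:R)
| ChainMessage (i : 'I_N.-1) of
    (forall f, I k.+1 f = ((f == inr i) + I k f)%N) &
    (forall j, (j <= i)%N -> xs (S k.+1) j = xs (S k) j) &
    xs (S k.+1) i.+1 <= xs (S k) i &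
    (forall j, xs (S k.+1) j <= xs (S k) j) &
    (forall j, Order.min (xs (S k) i) (xs (S k) j) <= xs (S k.+1) j).

Lemma chainP k : chain_move k.
Proof.
have [f [_ _ If Sf]] := chainS k; have [IH1 IH2] := config_inv k.
have B : events_before (T k.+1) (S k).
  by move=> l m /IH2 /le_trans; apply; exact: event_time_leS.
case: f If Sf => i If Sf.
- have [_ _ Q1 Q2] := step_local i IH1 B.
  apply: (@ChainLocal _ i) => [f|j]; first by rewrite If; case: eqP.
  rewrite Sf; have [->|ji] := eqVneq j i; first exact: Q1.
  by rewrite Q2// addr0.
- have [_ _ [Q1 Q2] Q3 Q4] := step_message i IH1 B.
  apply: (@ChainMessage _ i); rewrite ?Sf => //.
  by move=> f; rewrite If; case: eqP.
Qed.

Lemma xs_le_processed k (j : 'I_N) : xs (S k) j <= x0 j + (I k (inl j))%:Z.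
Proof.
elim: k => [|k IH]; first by rewrite addr0.
case: (chainP k) => i -> ; last first.
  by move=> _ _ /(_ j) + _; move/le_trans; apply.
move=> ->; have -> : (inl j == inl i :> flow N) = (j == i :> nat) by [].
by move: IH; case: eqP => _ /=; lia.
Qed.

(** Right after the last message from [i], at index [k'], the recipient is at most at [x_i]; from
    then on only its own local steps raise it. The left alternative is the case of no message so
    far. *)
Lemma xs_le_last_message k (i : 'I_N.-1) (j : 'I_N) : j = i.+1 :> nat ->
  (I k (inr i) = 0%N /\ xs (S k) j <= x0 j + (I k (inl j))%:Z) \/
  exists2 k', (k' <= k)%N & I k' (inr i) = I k (inr i) /\
    xs (S k) j <= xs (S k') i + (I k (inl j))%:Z - (I k' (inl j))%:Z.
Proof.
move=> ji; elim: k => [|k IH]; first by left; rewrite addr0.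
case: (chainP k) => i'.
  move=> II X; rewrite !II X/=.
  have -> : (inl j == inl i' :> flow N) = (j == i' :> nat) by [].
  case: IH => [[I0 xj]|[k' k'k [Ik' xj]]]; [left|right].
    by split => //; case: eqP => _; lia.
  exists k'; first exact: leqW.
  by split => //; case: eqP => _; lia.
move=> II X1 X2 X3 X4; have [ii'|ii'] := eqVneq i i'.
  right; exists k.+1 => //; split => //.
  by rewrite addrK ji ii' (X1 i').
rewrite !II/= (inj_eq inr_inj) (negbTE ii') /= !add0n.
case: IH => [[I0 xj]|[k' k'k [Ik' xj]]]; [left|right].
  by split => //; apply: le_trans (X3 _) xj.
by exists k'; [exact: leqW|split => //; apply: le_trans (X3 _) xj].
Qed.

End JumpChain.

(** * Linear bounds on local times when the flows keep to their rates *)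

Section Bounds.
Variables (R : realType) (N : nat) (lam beta : nat -> R) (x0 : nat -> int).
Hypothesis lam_gt0 : forall i, (i < N)%N -> 0 < lam i.
Hypothesis beta_gt0 : forall i, (i.+1 < N)%N -> 0 < beta i.

(** The condition [1 <= h] lets additive constants, such as initial positions, be absorbed into
    multiples of [h]. *)
Definition steady (E : flow N -> nat -> R) (h : R) (K : nat) : Prop :=
  [/\ forall f n, 0 <= E f n, 1 <= h & forall k f, (k <= K)%N ->
      `|(processed x0 E k f)%:R - flow_rate lam beta f * event_time x0 E k| <= h].

Lemma steady_ge E h K k f : steady E h K -> (k <= K)%N ->
  flow_rate lam beta f * event_time x0 E k - h <= (processed x0 E k f)%:R.
Proof. by move=> [_ _ H] kK; have := H k f kK; rewrite ler_norml => /andP[]; lra. Qed.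

Lemma steady_le E h K k f : steady E h K -> (k <= K)%N ->
  (processed x0 E k f)%:R <= flow_rate lam beta f * event_time x0 E k + h.
Proof. by move=> [_ _ H] kK; have := H k f kK; rewrite ler_norml => /andP[_]; lra. Qed.

(* Keeping the fluctuation [processed - lam j * t] inside the bound makes it
   invariant under local steps; a rollback of [j] caused by a message from
   [i < j] costs at most two fluctuations, whence the term [2 * h * j]. *)
Lemma lower_bound E h K c : steady E h K -> (forall i, (i < N)%N -> c <= (x0 i)%:~R) ->
  forall k (j : 'I_N), (k <= K)%N ->
  c - 2 * h * j%:R + ell lam j * event_time x0 E k +
    ((processed x0 E k (inl j))%:R - lam j * event_time x0 E k)
  <= (xs (config x0 E k) j)%:~R.
Proof.
move=> st cx0; have [E0 h1 _] := st.
elim=> [|k IH] j kK.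
  rewrite /event_time/= !mulr0 subr0 !addr0.
  by have := cx0 j (ltn_ord j); have := ler0n R j; nra.
have N0 : (0 < N)%N by apply: leq_ltn_trans (ltn_ord j).
have {}IH i := IH i (ltnW kK).
have TT := event_time_leS x0 N0 E0 k.
have T0 := event_time_ge0 x0 N0 E0 k.+1.
(* The total coefficient of time in the bound is nonpositive, so the bound only weakens while time
   passes. *)
have lT (i : 'I_N) : (ell lam i - lam i) * event_time x0 E k.+1 <=
                     (ell lam i - lam i) * event_time x0 E k.
  by rewrite ler_wnM2l// subr_le0 ell_le.
case: (chainP x0 N0 E0 k) => i.
  move=> II X; rewrite II X.
  have -> : (inl j == inl i :> flow N) = (j == i :> nat) by [].
  by have := IH j; have := lT j; case: eqP => _;
    rewrite intrD natrD ?mulr1z ?mulr0z /=; lra.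
move=> II X1 _ _ X4; have iN : (i < N)%N by have := ltn_ord i; lia.
have low (l : 'I_N) : xs (config x0 E k) l <= xs (config x0 E k.+1) l ->
    c - 2 * h * l%:R + ell lam l * event_time x0 E k.+1 +
    ((processed x0 E k.+1 (inl l))%:R - lam l * event_time x0 E k.+1)
    <= (xs (config x0 E k.+1) l)%:~R.
  rewrite -(ler_int R) => Xl.
  by rewrite II add0n; have := IH l; have := lT l; lra.
have := X4 j; rewrite ge_min => /orP[xij|]; last exact: low.
have [ji|ij] := leqP j i; first by apply: low; rewrite X1.
(* By [xij], [j] ends no lower than the sender [i], whose value is untouched; the bound for [i] then
   passes to [j] because [ell] is nonincreasing. *)
have := low (Ordinal iN); rewrite X1// => /(_ (lexx _)) /= lowi.
apply: le_trans (_ : (xs (config x0 E k) i)%:~R <= _); last by rewrite ler_int.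
apply: le_trans lowi.
have si := steady_ge (inl (Ordinal iN)) st kK.
have sj := steady_le (inl j) st kK.
have eij : ell lam j * event_time x0 E k.+1 <= ell lam i * event_time x0 E k.+1.
  by rewrite ler_wpM2r// ell_anti// ltnW.
have ij1 : (i%:R + 1 <= j%:R :> R) by rewrite natr1 ler_nat.
have := ler_wpM2l (ltW (lt_le_trans ltr01 h1)) ij1.
by move: si sj eij => /=; lra.
Qed.

Lemma upper_bound_own E h K k (j : 'I_N) : steady E h K -> (k <= K)%N ->
  (xs (config x0 E k) j)%:~R <=
    (x0 j)%:~R + lam j * event_time x0 E k + h.
Proof.
move=> st kK; have [E0 _ _] := st.
have N0 : (0 < N)%N by apply: leq_ltn_trans (ltn_ord j).
have := xs_le_processed x0 N0 E0 k j; rewrite -(ler_int R) intrD.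
by have /= := steady_le (inl j) st kK; rewrite -[(Posz _)%:~R]/(_%:R); lra.
Qed.

(** Induction on [j]. If [lam j.+1] is the new minimum, the processor's own count suffices.
    Otherwise [ell] does not change, and [j.+1] follows [j] up to the [O(h)] steps made since the
    last message. [C] depends on the rates and initial positions only. *)
Lemma upper_bound (j : nat) : (j < N)%N -> exists2 C, 0 <= C &
  forall E h K k, steady E h K -> (k <= K)%N ->
  (xs (config x0 E k) j)%:~R <= ell lam j * event_time x0 E k + C * h.
Proof.
have own (i : nat) : (i < N)%N -> ell lam i = lam i -> exists2 C, 0 <= C &
    forall E h K k, steady E h K -> (k <= K)%N ->
    (xs (config x0 E k) i)%:~R <= ell lam i * event_time x0 E k + C * h.
  move=> iN li; exists (`|(x0 i)%:~R| + 1); first by rewrite addr_ge0.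
  move=> E h K k st kK; have := upper_bound_own (Ordinal iN) st kK.
  rewrite /= li; have [_ h1 _] := st.
  have := ler_norm ((x0 i)%:~R : R); have := ler_peMr (normr_ge0 ((x0 i)%:~R : R)) h1.
  by lra.
elim: j => [|j IH] jN; first by apply: own => //; rewrite ell0.
have [C C0 HC] := IH (ltnW jN); have [lj|lj] := leP (lam j.+1) (ell lam j).
  by apply: own => //; rewrite ellS; apply: min_r.
have jN1 : (j < N.-1)%N by lia.
have b0 := beta_gt0 jN.
have l0 : 0 < lam j.+1 by exact: lam_gt0.
have N0 : (0 < N)%N by lia.
have e0 : 0 <= ell lam j by apply/le_ellP => i ij; apply/ltW/lam_gt0; lia.
(* [D] converts a bound on [beta j * dt] into one on [lam j.+1 * dt], that is, messages into local
   steps. *)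
pose D := lam j.+1 / beta j.
have D0 : 0 < D by exact: divr_gt0.
have lD : lam j.+1 = D * beta j by rewrite /D divfK ?gt_eqF.
clearbody D.
exists (C + 2 * D + 2 + `|(x0 j.+1)%:~R|).
  by rewrite !addr_ge0// mulr_ge0// ltW.
move=> E h K k st kK; have [E0 h1 _] := st.
have h0 : 0 <= h by lra.
rewrite ellS min_l ?(ltW lj)//.
have Tk0 := event_time_ge0 x0 N0 E0 k.
have eT := mulr_ge0 e0 Tk0.
have aj := ler_norm ((x0 j.+1)%:~R : R).
have ajh := ler_peMr (normr_ge0 ((x0 j.+1)%:~R : R)) h1.
have ajh0 := mulr_ge0 (normr_ge0 ((x0 j.+1)%:~R : R)) h0.
have Ch := mulr_ge0 C0 h0; have Dh := mulr_ge0 (ltW D0) h0.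
have := @xs_le_last_message _ _ x0 E N0 E0 k (Ordinal jN1) (Ordinal jN) erefl.
have skj := steady_le (inl (Ordinal jN)) st kK.
have sbk := steady_ge (inr (Ordinal jN1)) st kK.
case=> [[I0]|[k' k'k [II]]] /=; rewrite -(ler_int R) !intrD => xj.
  (* No message so far: a zero count forces [beta j * T <= h], so the elapsed time itself is
     [O(h)]. *)
  move: sbk skj => /=; rewrite I0 lD -mulrA => sbk skj.
  have := ler_wpM2l (ltW D0) (_ : beta j * event_time x0 E k <= h).
  by move=> /(_ ltac:(lra)); move: xj; rewrite -[(Posz _)%:~R]/(_%:R); lra.
have k'K := leq_trans k'k kK.
have sk'j := steady_ge (inl (Ordinal jN)) st k'K.
have sbk' := steady_le (inr (Ordinal jN1)) st k'K.
have TT := event_time_mono x0 N0 E0 k'k.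
have := HC E h K k' st k'K.
have eTT := ler_wpM2l e0 TT.
move: sbk sbk' skj sk'j xj => /=; rewrite II lD -!mulrA intrN => sbk sbk' skj sk'j xj.
(* The message counts at [k'] and [k] agree and each is within [h] of its nominal value. *)
have := ler_wpM2l (ltW D0) (_ : beta j * event_time x0 E k -
   beta j * event_time x0 E k' <= 2 * h).
move=> /(_ ltac:(lra)); move: xj.
by rewrite -[(Posz (processed x0 E k _))%:~R]/(_%:R) -[(Posz (processed x0 E k' _))%:~R]/(_%:R); lra.
Qed.

End Bounds.

(** * From deviations of arrival times to the position at a given time *)

Section SpeedError.
Variables (R : realType) (N : nat) (lam beta : nat -> R) (x0 : nat -> int).
Hypothesis lam_gt0 : forall i, (i < N)%N -> 0 < lam i.
Hypothesis beta_gt0 : forall i, (i.+1 < N)%N -> 0 < beta i.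

Lemma flow_rate_gt0 (f : flow N) : 0 < flow_rate lam beta f.
Proof.
case: f => i /=; first exact: lam_gt0.
by apply: beta_gt0; have := ltn_ord i; lia.
Qed.

(** If the time were still at most [t] after one event more than [M] per flow, every flow would have
    consumed at most [M] points, contradicting the total. [K.+1] is the first event past [t]. *)
Lemma event_time_bracket (E : flow N -> nat -> R) (t : R) (M : nat) :
  (0 < N)%N -> (forall f n, 0 <= E f n) -> 0 <= t ->
  (forall f, t < wait_sum E f M) ->
  exists K, event_time x0 E K <= t < event_time x0 E K.+1.
Proof.
move=> N0 E0 t0 tM.
have ex : exists k, t < event_time x0 E k.
  exists (\sum_(f : flow N) M).+1; rewrite ltNge; apply/negP => Tt.
  have : (\sum_(f : flow N) processed x0 E (\sum_(f : flow N) M).+1 f <= \sum_(f : flow N) M)%N.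
    apply: leq_sum => f _; rewrite leqNgt; apply/negP => Mf.
    have := tM f; rewrite ltNge => /negP; apply.
    apply: le_trans (wait_sum_mono E0 f (ltnW Mf)) (le_trans _ Tt).
    by have /andP[] := processed_time x0 N0 E0 (\sum_(f : flow N) M).+1 f.
  by rewrite processed_sum// ltnn.
have [[|K] tK Kmin] := ex_minnP ex; first by move: tK; rewrite ltNge t0.
exists K; rewrite tK andbT leNgt; apply/negP => /Kmin; by rewrite ltnn.
Qed.

(** Deterministic core: control of arrival times is inverted into control of counts, that is
    [steady], and the two linear bounds are applied at the last event before [t]. *)
Lemma speed_error j : (j < N)%N -> exists2 C, 0 <= C &
  forall (E : flow N -> nat -> R) (eta t : R) (M : nat),
    (forall f n, 0 <= E f n) -> 0 <= eta -> 0 <= t ->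
    (forall f : flow N, t + eta < M%:R / flow_rate lam beta f) ->
    (forall (f : flow N) n, (n <= M)%N ->
      `|wait_sum E f n - n%:R / flow_rate lam beta f| <= eta) ->
  exists v : int, position_at x0 E t j v /\
    `|v%:~R - ell lam j * t| <= C * (eta + 1).
Proof.
move=> jN; have N0 : (0 < N)%N by lia.
have [C C0 HC] := upper_bound x0 lam_gt0 beta_gt0 jN.
pose Rm := \sum_(f : flow N) flow_rate lam beta f.
have Rm_ge (f : flow N) : flow_rate lam beta f <= Rm.
  rewrite /Rm (bigD1 f)//= lerDl; apply: sumr_ge0 => g _.
  exact/ltW/flow_rate_gt0.
have Rm0 : 0 <= Rm by apply: sumr_ge0 => f _; exact/ltW/flow_rate_gt0.
pose c : R := \sum_(i < N) `|(x0 i)%:~R|.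
have c0 : 0 <= c by exact: sumr_ge0.
have cx0 i : (i < N)%N -> - c <= (x0 i)%:~R.
  move=> iN; rewrite lerNl; apply: le_trans (ler_norm _) _; rewrite normrN.
  by rewrite /c (bigD1 (Ordinal iN))//= lerDl; exact: sumr_ge0.
(* [C] serves the upper bound; the lower one costs [c], [2 * j * h], one fluctuation [h] and [2 * h]
   for the gap between the last event and [t]. The factor [Rm + 1] comes from
   [h <= (Rm + 1) * (eta + 1)]. *)
exists ((C + 2 * j%:R + 3 + c) * (Rm + 1)).
  by rewrite mulr_ge0// !addr_ge0// mulr_ge0.
move=> E eta t M E0 eta0 t0 tM dev.
have tM' (f : flow N) : t < wait_sum E f M.
  by have := dev f M (leqnn _); have := tM f; rewrite ler_norml => ? /andP[? _]; lra.
have [K /andP[TK tK]] := event_time_bracket N0 E0 t0 tM'.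
(* A time error [eta] shifts a count by at most its rate times [eta]; the [1] accounts for the
   pending point. *)
pose h := Rm * eta + 1.
have h1 : 1 <= h by rewrite lerDr mulr_ge0.
(* Strict, because [next] uses the deviation bound at the pending point, whose index is one
   larger. *)
have idxM k f : (k <= K)%N -> (processed x0 E k f < M)%N.
  move=> kK; rewrite ltnNge; apply/negP => Mk.
  have := tM' f; rewrite ltNge => /negP; apply.
  apply: le_trans (wait_sum_mono E0 f Mk) (le_trans _ TK).
  apply: le_trans (event_time_mono x0 N0 E0 kK).
  by have /andP[] := processed_time x0 N0 E0 k f.
have next k f : (k <= K)%N -> flow_rate lam beta f * wait_sum E f (processed x0 E k f).+1
    <= (processed x0 E k f)%:R + 1 + flow_rate lam beta f * eta.
  move=> kK; have r0 := flow_rate_gt0 f.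
  have := dev f _ (idxM k f kK); rewrite ler_norml => /andP[_].
  rewrite lerBlDr -(ler_pM2l r0) mulrDr [_ * (_ / _)]mulrC divfK ?gt_eqF// -natr1; lra.
have prev k f : (k <= K)%N -> (processed x0 E k f)%:R - flow_rate lam beta f * eta
    <= flow_rate lam beta f * event_time x0 E k.
  move=> kK; have r0 := flow_rate_gt0 f.
  have := dev f _ (ltnW (idxM k f kK)); rewrite ler_norml => /andP[+ _].
  rewrite lerBrDr -(ler_pM2l r0) mulrDr [_ * (_ / _)]mulrC divfK ?gt_eqF//.
  have /andP[/(ler_wpM2l (ltW r0)) + _] := processed_time x0 N0 E0 k f.
  by lra.
have st : steady lam beta x0 E h K.
  split => // k f kK; have r0 := flow_rate_gt0 f.
  have reta : flow_rate lam beta f * eta <= Rm * eta by rewrite ler_wpM2r.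
  have := next k f kK; have := prev k f kK.
  have /andP[_ /(ler_wpM2l (ltW r0))] := processed_time x0 N0 E0 k f.
  by rewrite ler_norml /h => ? ? ?; apply/andP; split; lra.
exists (xs (config x0 E K) j); split; first by exists K; rewrite TK tK.
have up := HC E h K K st (leqnn _).
have /= lo := lower_bound st cx0 (Ordinal jN) (leqnn K).
have /= sg := steady_ge (inl (Ordinal jN)) st (leqnn K).
have l0 : 0 < lam j by exact: lam_gt0.
have e0 : 0 <= ell lam j by apply/le_ellP => i ij; apply/ltW/lam_gt0; lia.
have el : ell lam j <= lam j by exact: ell_le.
have eTt : ell lam j * event_time x0 E K <= ell lam j * t by rewrite ler_wpM2l.
have leta : lam j * eta <= Rm * eta.
  by rewrite ler_wpM2r//; exact: (Rm_ge (inl (Ordinal jN))).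
(* [t] precedes the next event, hence also the pending local step of [j]. *)
have gap : lam j * t <= lam j * event_time x0 E K + 2 * h.
  have := next K (inl (Ordinal jN)) (leqnn _); have := prev K (inl (Ordinal jN)) (leqnn _).
  have [g [_ Tn _ _]] := chainS x0 E N0 K.
  have /(ler_wpM2l (ltW l0)) := ltW (lt_le_trans tK (Tn (inl (Ordinal jN)))).
  by rewrite /h /=; lra.
have gape : ell lam j * t <= ell lam j * event_time x0 E K + 2 * h.
  have : ell lam j * (t - event_time x0 E K) <= lam j * (t - event_time x0 E K).
    by rewrite ler_wpM2r// subr_ge0.
  lra.
have hb : h <= (Rm + 1) * (eta + 1) by rewrite /h; nra.
have ch : c <= c * h by rewrite ler_peMr.
have jh : 0 <= j%:R * h by rewrite mulr_ge0//; lra.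
have Ch : 0 <= C * h by rewrite mulr_ge0//; lra.
have -> : (C + 2 * j%:R + 3 + c) * (Rm + 1) * (eta + 1) =
    (C + 2 * j%:R + 3 + c) * ((Rm + 1) * (eta + 1)) by rewrite mulrA.
apply: le_trans (_ : (C + 2 * j%:R + 3 + c) * h <= _).
  by rewrite ler_norml; apply/andP; split; lra.
by apply: ler_wpM2l hb; rewrite !addr_ge0// mulr_ge0.
Qed.

End SpeedError.

(** * Measurability: the chain depends only on the order of the instants *)

Section Retime.
Variables (R : realType) (N : nat).
Variables (D : R -> Prop) (phi : R -> R).
Hypothesis D0 : D 0.
Hypothesis phi0 : phi 0 = 0.
Hypothesis phi_mono : forall x y, D x -> D y -> (phi x < phi y) = (x < y).

Definition retime_seq (h : seq (R * int)) := [seq (phi m.1, m.2) | m <- h].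

Definition retime (s : cstate R) : cstate R :=
  CState (xs s) (retime_seq \o hist s) (retime_seq \o sent s).

(** [phi] preserves order only on [D], so all stored instants must lie there; [D 0] covers the
    default of [last_incr_time]. *)
Definition times_in (s : cstate R) : Prop :=
  forall l m, m \in hist s l \/ m \in sent s l -> D m.1.

Lemma upd_comp (T U : Type) (g : T -> U) (f : nat -> T) k v :
  upd (g \o f) k (g v) = g \o upd f k v.
Proof. by apply/funext => i; rewrite /upd/=; case: eqP. Qed.

Lemma last_incr_time_retime h v :
  last_incr_time (retime_seq h) v = phi (last_incr_time h v).
Proof.
rewrite /last_incr_time filter_map (@eq_filter _ _ (fun p => p.2 == v))//.
by case: [seq p <- h | p.2 == v] => [|[t w] c].
Qed.

Lemma last_incr_time_in s l v : times_in s -> D (last_incr_time (hist s l) v).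
Proof.
move=> Ds; rewrite /last_incr_time.
case E : [seq p <- hist s l | p.2 == v] => [//|[t w] c].
apply: (Ds l (t, w)); left.
have : (t, w) \in [seq p <- hist s l | p.2 == v] by rewrite E mem_head.
by rewrite mem_filter => /andP[].
Qed.

(** Rollbacks use instants only in strict comparisons, so they commute with an order-preserving
    change of instants. *)
Lemma rollback_retime fuel l v sg s : times_in s -> D sg ->
  rollback N fuel l v (phi sg) (retime s) = retime (rollback N fuel l v sg s)
  /\ times_in (rollback N fuel l v sg s).
Proof.
(* [b] is [negb] for the kept messages and [id] for the cancelled ones. *)
have win (h : seq (R * int)) th (b : bool -> bool) : D th -> D sg ->
    (forall m, m \in h -> D m.1) ->
    [seq m <- retime_seq h | b ((phi th < m.1) && (m.1 < phi sg))] =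
    retime_seq [seq m <- h | b ((th < m.1) && (m.1 < sg))].
  move=> Dth Dsg Dh; rewrite /retime_seq filter_map; congr (map _ _).
  by apply: eq_in_filter => m /Dh Dm /=; rewrite !phi_mono.
have foldE w c : foldr (fun m acc => Order.min m.2 acc) w (retime_seq c) =
    foldr (fun (m : R * int) acc => Order.min m.2 acc) w c.
  by elim: c => //= m c ->.
have truncE l' v' s' : times_in s' -> D sg ->
    truncate l' v' (phi sg) (retime s') = retime (truncate l' v' sg s') /\
    times_in (truncate l' v' sg s').
  move=> Ds' Dsg; split.
    rewrite /truncate /retime /= last_incr_time_retime (win _ _ negb)//.
    - by rewrite upd_comp.
    - exact: last_incr_time_in.
    - by move=> m ml; apply: (Ds' l'); right.
  move=> i m [mh|]; first by apply: (Ds' i); left.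
  rewrite /= /upd; case: eqP => _ mi; last by apply: (Ds' i); right.
  by apply: (Ds' l'); right; move: mi; rewrite mem_filter => /andP[].
elim: fuel l v s => [|fuel IH] l v s Ds Dsg; first exact: truncE.
have [E1 D1] := truncE l v s Ds Dsg.
rewrite /= -/(truncate l v sg s) -/(truncate l v (phi sg) (retime s)) E1.
rewrite last_incr_time_retime (win _ _ id)//; last 2 first.
- exact: last_incr_time_in.
- by move=> m ml; apply: (Ds l); right.
rewrite foldE /=; case: ifP => _; [exact: IH|by []].
Qed.

Lemma step_retime (f : flow N) sg s : times_in s -> D sg ->
  step f (phi sg) (retime s) = retime (step f sg s) /\ times_in (step f sg s).
Proof.
move=> Ds Dsg; case: f => k /=.
  split; first by rewrite /retime /= -upd_comp.
  move=> l m [|ml]; last by apply: (Ds l); right.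
  rewrite /= /upd; case: eqP => _ mi; last by apply: (Ds l); left.
  by move: mi; rewrite inE => /predU1P[->//|mi]; apply: (Ds k); left.
set s2 := CState _ _ _; set s1 := CState _ _ _.
have D1 : times_in s1.
  move=> l m [mh|]; first by apply: (Ds l); left.
  rewrite /= /upd; case: eqP => _ mi; last by apply: (Ds l); right.
  by move: mi; rewrite inE => /predU1P[->//|mi]; apply: (Ds k); right.
have -> : s2 = retime s1 by rewrite /s2 /s1 /retime /= -upd_comp.
case: ifP => _; [exact: rollback_retime|by []].
Qed.

(** Both chains pick the same flow at each step. The bound [processed <= k] is carried along to keep
    the arrivals consulted within the range [n <= K]. *)
Lemma chain_retime (x0 : nat -> int) (E E' : flow N -> nat -> R) K :
  (forall f n, (n <= K)%N -> D (arrival E f n) /\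
                             phi (arrival E f n) = arrival E' f n) ->
  forall k, (k <= K.+1)%N ->
  [/\ config x0 E' k = retime (config x0 E k), times_in (config x0 E k),
      processed x0 E' k = processed x0 E k,
      event_time x0 E' k = phi (event_time x0 E k) /\ D (event_time x0 E k) &
      forall f, (processed x0 E k f <= k)%N].
Proof.
move=> H; elim=> [|k IH] kK; first by split => // l m [].
have {IH} := IH (ltnW kK); rewrite /config /processed /event_time /=.
case: (chain x0 E k) => [[s idx] t]; case: (chain x0 E' k) => [[s' idx'] t'] /=.
move=> [-> Ds -> [-> Dt] idxk].
have Hf f := H f (idx f) (leq_trans (idxk f) kK).
rewrite (@eq_pick _ _
  (fun f => [forall g, arrival E f (idx f) <= arrival E g (idx g)])); last first.
  move=> f; apply: eq_forallb => g.
  have [Df <-] := Hf f; have [Dg <-] := Hf g.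
  by rewrite !leNgt phi_mono.
case: pickP => [f _|_]; last by split => // f; exact/leqW.
have [Df <-] := Hf f; have [E1 D1] := step_retime f Ds Df.
split => //= g; case: eqP => _; first by rewrite ltnS.
exact/leqW.
Qed.

End Retime.

(** * Positions as functions of finite order patterns, and their measurability *)

Section OrderPattern.
Variables (R : realType) (N : nat) (t : R) (K : nat).

(** The finitely many instants that can matter for the first [K.+1] events; [true] stands for [t],
    [false] for the origin. *)
Definition instant := (flow N * 'I_K.+1 + bool)%type.

Definition instant_time (E : flow N -> nat -> R) (r : instant) : R :=
  match r with inl p => arrival E p.1 p.2 | inr b => if b then t else 0 end.

Definition order_pattern (E : flow N -> nat -> R) : {ffun instant * instant -> bool} :=
  [ffun p => instant_time E p.1 < instant_time E p.2].

Lemma position_at_order_pattern x0 (Q : int -> Prop) j (E E' : flow N -> nat -> R) :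
  order_pattern E = order_pattern E' ->
  event_time x0 E K <= t < event_time x0 E K.+1 /\ Q (xs (config x0 E K) j) ->
  event_time x0 E' K <= t < event_time x0 E' K.+1 /\ Q (xs (config x0 E' K) j).
Proof.
move=> pE.
have ltE r r' : (instant_time E r < instant_time E r') =
                (instant_time E' r < instant_time E' r').
  by have /ffunP/(_ (r, r')) := pE; rewrite !ffunE.
(* Sends each instant of [E] to the same-named one of [E']; any choice among ties works, since equal
   patterns have equal ties. *)
pose phi x := if [pick r | instant_time E r == x] is Some r
              then instant_time E' r else 0.
have phiE r : phi (instant_time E r) = instant_time E' r.
  rewrite /phi; case: pickP => [r' /eqP rr'|/(_ r)]; last by rewrite eqxx.
  by apply/eqP; rewrite eq_le !leNgt -!ltE rr' ltxx.
pose D x := exists r, x = instant_time E r.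
have D0 : D 0 by exists (inr false).
have Dt : D t by exists (inr true).
have phi0 : phi 0 = 0 := phiE (inr false).
have phit : phi t = t := phiE (inr true).
have phi_mono x y : D x -> D y -> (phi x < phi y) = (x < y).
  by move=> [r ->] [r' ->]; rewrite !phiE ltE.
have HK f n : (n <= K)%N -> D (arrival E f n) /\ phi (arrival E f n) = arrival E' f n.
  rewrite -ltnS => nK.
  by split; [exists (inl (f, Ordinal nK))|rewrite (phiE (inl (f, Ordinal nK)))].
have [-> _ _ [-> D1] _] := chain_retime D0 phi0 phi_mono x0 HK (leqnSn K).
have [_ _ _ [-> D2] _] := chain_retime D0 phi0 phi_mono x0 HK (leqnn K.+1).
by rewrite /= -{3 4}phit !leNgt !phi_mono.
Qed.

End OrderPattern.

Lemma measurable_finite_factor d (T : measurableType d) (F : finType)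
    (pat : T -> F) (A : set T) :
  (forall p, measurable [set w | pat w = p]) ->
  (forall w w', pat w = pat w' -> A w -> A w') -> measurable A.
Proof.
move=> mp HA.
have -> : A = \bigcup_(p in [set p | exists2 w, A w & pat w = p])
    [set w | pat w = p].
  apply/seteqP; split => w; first by move=> Aw; exists (pat w) => //; exists w.
  by move=> [p [w' Aw' pw'] /= pw]; apply: HA Aw'; rewrite pw' pw.
by apply: fin_bigcup_measurable => // p _; exact: mp.
Qed.

Lemma measurable_wait_sum d (T : measurableType d) (R : realType) (N : nat)
    (E : flow N -> nat -> T -> R) f n :
  (forall f n, measurable_fun setT (E f n)) ->
  measurable_fun setT (fun w => wait_sum (fun f n => E f n w) f n).
Proof. by move=> mE; exact: measurable_sum. Qed.

(** A countable union over the event index; each piece is decided by an order pattern, that is, by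
    finitely many comparisons of measurable functions. *)
Lemma measurable_position_at d (T : measurableType d) (R : realType) (N : nat)
    (E : flow N -> nat -> T -> R) x0 t j (Q : int -> Prop) :
  (forall f n, measurable_fun setT (E f n)) ->
  measurable [set w | exists v, position_at x0 (fun f n => E f n w) t j v /\ Q v].
Proof.
move=> mE; set A := [set _ | _].
have -> : A = \bigcup_k [set w | let Ew := fun f n => E f n w in
    event_time x0 Ew k <= t < event_time x0 Ew k.+1 /\ Q (xs (config x0 Ew k) j)].
  apply/seteqP; split => w; first by move=> [v [[k [tk <-]] Qv]]; exists k.
  by move=> [k _ [tk Qv]]; exists (xs (config x0 (fun f n => E f n w) k) j); split => //; exists k.
apply: bigcupT_measurable => k.
apply: (@measurable_finite_factor _ _ _
  (fun w => order_pattern t k (fun f n => E f n w))); last first.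
  by move=> w w' ww'; exact: position_at_order_pattern.
move=> p.
have -> : [set w | order_pattern t k (fun f n => E f n w) = p] =
    \bigcap_(q in setT) [set w | (instant_time t (fun f n => E f n w) q.1 <
                  instant_time t (fun f n => E f n w) q.2) = p q].
  apply/seteqP; split => w; first by move=> /= <- q _ /=; rewrite ffunE.
  by move=> H; apply/ffunP => q; rewrite ffunE; exact: H.
apply: fin_bigcap_measurable => [|q _]; first exact: finite_finset.
have mi (r : instant N k) : measurable_fun setT (fun w => instant_time t (fun f n => E f n w) r).
  by case: r => [[f n]|b] /=; [exact: measurable_wait_sum|exact: measurable_cst].
have := measurable_fun_ltr (mi q.1) (mi q.2).
by move=> /(_ measurableT [set p q] Logic.I); rewrite setTI.
Qed.

(** * Law of large numbers for exponential waiting times *)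

Section LayerCake.
Local Open Scope ereal_scope.
Context {d : measure_display} {T : measurableType d} {R : realType}
  (P : probability T R).
Let mu : {sigma_finite_measure set _ -> \bar R} := @lebesgue_measure R.

Lemma measurable_above (U : T -> R) s : measurable_fun setT U ->
  measurable [set w | (s < U w)%R].
Proof.
move=> mU; have /(_ measurableT [set true]) :=
  measurable_fun_ltr (@measurable_cst _ _ _ _ setT s) mU.
by rewrite setTI; apply.
Qed.

Lemma ge0_integral_tail (V : T -> R) : measurable_fun setT V ->
  (forall w, (0 <= V w)%R) ->
  \int[P]_w (V w)%:E = \int[mu]_(r in `[0%R, +oo[) P [set w | (r < V w)%R].
Proof.
move=> mV V0; pose VX : {RV P >-> R} := mfun_Sub (mem_set mV : V \in mfun).
have := @ge0_expectation_ccdf _ _ _ P VX V0.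
rewrite expectation_def => ->; apply: eq_integral => r _.
rewrite /ccdf /distribution /pushforward; congr (P _).
by apply/seteqP; split => w /=; rewrite in_itv/= andbT.
Qed.

Variables U V : T -> R.
Hypotheses (mU : measurable_fun setT U) (mV : measurable_fun setT V).
Hypotheses (U_ge0 : forall w, (0 <= U w)%R) (V_ge0 : forall w, (0 <= V w)%R).

Definition mean_above (s : R) : \bar R :=
  \int[P]_w (V w * \1_[set w | (s < U w)%R] w)%:E.

Lemma mean_aboveE s : mean_above s =
  \int[mu]_(r in `[0%R, +oo[) P [set w | (s < U w)%R /\ (r < V w)%R].
Proof.
rewrite /mean_above ge0_integral_tail; last 2 first.
- by apply: measurable_funM => //; apply: measurable_indic; exact: measurable_above.
- by move=> w; rewrite mulr_ge0.
apply: eq_integral => r; rewrite inE/= in_itv/= andbT => r0; congr (P _).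
apply/seteqP; split => w /=; rewrite indicE.
  have [/set_mem /= sU|_] := boolP (w \in _); rewrite ?mulr1 ?mulr0 //.
  by rewrite ltNge r0.
by move=> [sU rV]; rewrite mem_set// mulr1.
Qed.

(** Joint measurability for Tonelli. The constraint [0 <= s] is part of the integrand, so that [s]
    can run over the whole line. *)
Let above_measurable :
  measurable_fun setT (fun p : T * measurableTypeR R =>
    (V p.1 * \1_[set p : T * measurableTypeR R | (0 <= p.2)%R && (p.2 < U p.1)%R] p)%:E).
Proof.
apply/measurable_EFinP; apply: measurable_funM; first exact: measurableT_comp.
apply: measurable_indic.
have : measurable_fun setT (fun p : T * measurableTypeR R => (0 <= p.2)%R && (p.2 < U p.1)%R).
  apply: measurable_and; first exact: measurable_fun_ler.
  apply: measurable_fun_ltr => //; exact: measurableT_comp.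
by move=> /(_ measurableT [set true]); rewrite setTI; exact.
Qed.

(** Writes [U w] as the length of [[0, U w[] and exchanges integrals. With [mean_aboveE], the mean
    of [U * V] becomes a double integral of joint tails. *)
Lemma ge0_integral_mean_above : measurable_fun (`[0%R, +oo[ : set R) mean_above /\
  \int[P]_w (U w * V w)%:E = \int[mu]_(s in `[0%R, +oo[) mean_above s.
Proof.
have mF := above_measurable; set F := (fun p => _) in mF.
have F0 p : 0 <= F p by rewrite lee_fin mulr_ge0.
have FE s : (0 <= s)%R -> mean_above s = \int[P]_w F (w, s).
  move=> s0; apply: eq_integral => w _; rewrite /F/= !indicE.
  by congr (_ * (nat_of_bool _)%:R)%:E; apply/idP/idP; rewrite !inE/= s0.
have FE0 s : (s < 0)%R -> \int[P]_w F (w, s) = 0.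
  move=> s0; apply: integral0_eq => w _; rewrite /F/= indicE memNset ?mulr0//=.
  by rewrite leNgt s0.
split.
  apply: eq_measurable_fun (_ : measurable_fun _ (fun s => \int[P]_w F (w, s))).
    by move=> s; rewrite inE/= in_itv/= andbT => s0; rewrite FE.
  apply: measurable_funTS.
  exact: (measurable_fun_fubini_tonelli_G (m1 := P) F).
transitivity (\int[P]_w \int[mu]_s F (w, s)).
  apply: eq_integral => w _; rewrite /F /=.
  transitivity (\int[mu]_s ((V w)%:E * (\1_(`[0%R, U w[ : set R) s)%:E)).
    have mI : measurable_fun setT (fun s : R => (\1_(`[0%R, U w[ : set R) s)%:E : \bar R).
      by apply/measurable_EFinP; exact: measurable_indic.
    rewrite ge0_integralZl_EFin//.
    rewrite integral_indic// setIT /mu/= lebesgue_measure_itv/= lte_fin.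
    rewrite mulrC EFinM; case: ltP => [_|Uw]; first by rewrite sube0.
    by have /le_anti -> : (U w <= 0 <= U w)%R by rewrite Uw U_ge0.
  apply: eq_integral => s _; rewrite -EFinM !indicE; congr (_ * (nat_of_bool _)%:R)%:E.
rewrite (fubini_tonelli (m1 := P) (m2 := mu) F)// [RHS]integral_mkcond/=.
apply: eq_integral => s _; rewrite patchE; case: ifPn.
  by rewrite inE/= in_itv/= andbT => s0; rewrite FE.
by rewrite notin_setE/= in_itv/= andbT => /negP; rewrite -ltNge => /FE0.
Qed.

End LayerCake.

(** * Moments and uniform deviations of sums of exponential waiting times *)

Section ExponentialMoments.
Local Open Scope ereal_scope.
Context {d : measure_display} {T : measurableType d} {R : realType}
  (P : probability T R).
Let mu : {sigma_finite_measure set _ -> \bar R} := @lebesgue_measure R.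

Lemma measurable_expRNM (a : R) (D : set R) :
  measurable_fun D (fun s : R => (expR (- (a * s)))%:E).
Proof.
apply/measurable_EFinP; apply: measurable_funTS.
by apply: measurableT_comp => //; exact: measurableT_comp.
Qed.

Let integralZl_expRNM (k a : R) : (0 <= k)%R ->
  \int[mu]_(s in `[0%R, +oo[) (k%:E * (expR (- (a * s)))%:E) =
  k%:E * \int[mu]_(s in `[0%R, +oo[) (expR (- (a * s)))%:E.
Proof.
by move=> k0; apply: ge0_integralZl_EFin => //; exact: measurable_expRNM.
Qed.

Lemma integral_expRNM (a : R) : (0 < a)%R ->
  \int[mu]_(s in `[0%R, +oo[) (expR (- (a * s)))%:E = (a^-1)%:E.
Proof.
move=> a0; have := integral_exponential_pdf a0.
set J := \int[mu]_(s in _) _ => J1.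
have aJ : a%:E * J = 1.
  rewrite -J1 -integralZl_expRNM; last exact: ltW.
  rewrite integral_mkcond; apply: eq_integral => s _.
  by rewrite /exponential_pdf !patchE; case: ifP => //; rewrite -EFinM mulNr.
have : (a^-1)%:E * (a%:E * J) = (a^-1)%:E by rewrite aJ mule1.
by rewrite muleA -EFinM mulVf ?gt_eqF// mul1e.
Qed.

Variables (a : R) (X : nat -> {RV P >-> R}).
Hypothesis a_gt0 : (0 < a)%R.
Hypothesis X_exp : forall n, exponential_rv P a (X n).
Hypothesis X_indep : forall i j (s r : R), i != j ->
  P [set w | (s < X i w)%R /\ (r < X j w)%R] =
  P [set w | (s < X i w)%R] * P [set w | (r < X j w)%R].

(** The tail formula makes [X n] nonnegative only almost surely; the positive part is so everywhere,
    as the layer-cake formula and the monotone partial sums require. *)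
Definition pos_wait n w : R := Num.max (X n w) 0%R.

Lemma pos_wait_ge0 n w : (0 <= pos_wait n w)%R.
Proof. by rewrite le_max lexx orbT. Qed.

Lemma measurable_pos_wait n : measurable_fun setT (pos_wait n).
Proof. exact: measurable_funrpos. Qed.

Lemma lt_pos_wait n w s : (0 <= s)%R -> (s < pos_wait n w)%R = (s < X n w)%R.
Proof. by move=> s0; rewrite lt_max [(s < 0)%R]ltNge s0 orbF. Qed.

Lemma pos_wait_tail n s : (0 <= s)%R ->
  P [set w | (s < pos_wait n w)%R] = (expR (- (a * s)))%:E.
Proof.
move=> s0; rewrite -(X_exp n s0); congr (P _).
by apply/seteqP; split => w /=; rewrite lt_pos_wait.
Qed.

Lemma integral_pos_wait n : \int[P]_w (pos_wait n w)%:E = (a^-1)%:E.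
Proof.
rewrite ge0_integral_tail; last 2 first.
- exact: measurable_pos_wait.
- exact: pos_wait_ge0.
rewrite -integral_expRNM//; apply: eq_integral => s.
by rewrite inE/= in_itv/= andbT => s0; rewrite pos_wait_tail.
Qed.

(** Independence factors the joint tail, and the double integral with it. *)
Lemma integral_pos_wait_mul i j : i != j ->
  \int[P]_w (pos_wait i w * pos_wait j w)%:E = (a^-1 * a^-1)%:E.
Proof.
move=> ij.
have [_ ->] := ge0_integral_mean_above P (measurable_pos_wait i) (measurable_pos_wait j)
  (pos_wait_ge0 i) (pos_wait_ge0 j).
transitivity (\int[mu]_(s in `[0%R, +oo[) ((a^-1)%:E * (expR (- (a * s)))%:E)).
  apply: eq_integral => s; rewrite inE/= in_itv/= andbT => s0.
  rewrite (mean_aboveE P (measurable_pos_wait i) (measurable_pos_wait j) (pos_wait_ge0 j)).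
  rewrite muleC -(integral_expRNM a_gt0) -integralZl_expRNM ?expR_ge0//.
  apply: eq_integral => r; rewrite inE/= in_itv/= andbT => r0.
  rewrite -(X_exp i s0) -(X_exp j r0) -X_indep//; congr (P _).
  by apply/seteqP; split => w /=; rewrite !lt_pos_wait.
rewrite integralZl_expRNM; last by rewrite invr_ge0 ltW.
by rewrite integral_expRNM.
Qed.

(* [max s r >= (s + r) / 2] makes the double tail integral factor. *)
Lemma integral_pos_wait_sqr i :
  \int[P]_w (pos_wait i w * pos_wait i w)%:E <= (4 * (a^-1 * a^-1))%:E.
Proof.
have b0 : (0 < a / 2)%R by rewrite divr_gt0.
have [mH ->] := ge0_integral_mean_above P (measurable_pos_wait i) (measurable_pos_wait i)
  (pos_wait_ge0 i) (pos_wait_ge0 i).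
have -> : (4 * (a^-1 * a^-1) = (a / 2)^-1 * (a / 2)^-1)%R by field; rewrite gt_eqF.
apply: (@le_trans _ _
  (\int[mu]_(s in `[0%R, +oo[) (((a / 2)^-1)%:E * (expR (- (a / 2 * s)))%:E))); last first.
  rewrite integralZl_expRNM; last by rewrite invr_ge0 ltW.
  by rewrite integral_expRNM.
apply: ge0_le_integral => //.
- by move=> s _; apply: integral_ge0 => w _; rewrite lee_fin mulr_ge0// pos_wait_ge0.
- by apply: measurable_funeM; exact: measurable_expRNM.
move=> s; rewrite /= in_itv/= andbT => s0.
rewrite (mean_aboveE P (measurable_pos_wait i) (measurable_pos_wait i) (pos_wait_ge0 i)).
rewrite muleC -(integral_expRNM b0) -integralZl_expRNM ?expR_ge0//.
have PE r : (0 <= r)%R -> P [set w | (s < pos_wait i w)%R /\ (r < pos_wait i w)%R] =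
    (expR (- (a * Num.max s r)))%:E.
  move=> r0; rewrite -(@pos_wait_tail i) ?le_max ?s0//; congr (P _).
  apply/seteqP; split => w /=; first by move=> [sw rw]; rewrite gt_max sw.
  by rewrite gt_max => /andP[].
apply: ge0_le_integral => //.
- apply: eq_measurable_fun (_ : measurable_fun _ (fun r => (expR (- (a * Num.max s r)))%:E)).
    by move=> r; rewrite inE/= in_itv/= andbT => r0; rewrite PE.
  apply/measurable_EFinP; apply: measurable_funTS.
  apply: measurableT_comp => //; apply: measurableT_comp => //.
  by apply: measurable_funM => //; exact: measurable_maxr.
- by apply: measurable_funeM; exact: measurable_expRNM.
move=> r; rewrite /= in_itv/= andbT => r0; rewrite PE// -EFinM lee_fin -expRD ler_expR.
have : (s <= Num.max s r)%R /\ (r <= Num.max s r)%R by rewrite !le_max !lexx orbT.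
by move=> []; nra.
Qed.

Definition pos_sum n w : R := (\sum_(i < n) pos_wait i w)%R.

Lemma measurable_pos_sum n : measurable_fun setT (pos_sum n).
Proof. by apply: measurable_sum => i; exact: measurable_pos_wait. Qed.

Lemma pos_sum_ge0 n w : (0 <= pos_sum n w)%R.
Proof. by apply: sumr_ge0 => i _; exact: pos_wait_ge0. Qed.

Lemma pos_sum_mono m n w : (m <= n)%N -> (pos_sum m w <= pos_sum n w)%R.
Proof.
move/subnK <-; elim: (n - m)%N => //= k IH.
rewrite addSn /pos_sum big_ord_recr/=; apply: le_trans IH _.
by rewrite lerDl pos_wait_ge0.
Qed.

Lemma integral_pos_sum n : \int[P]_w (pos_sum n w)%:E = (n%:R / a)%:E.
Proof.
under eq_integral do rewrite /pos_sum -sumEFin.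
rewrite ge0_integral_sum//; last 2 first.
- by move=> i; apply/measurable_EFinP; exact: measurable_pos_wait.
- by move=> i w _; rewrite lee_fin pos_wait_ge0.
under eq_bigr do rewrite integral_pos_wait.
by rewrite sumEFin sumr_const card_ord mulr_natl.
Qed.

(** Off-diagonal products contribute [1] and diagonal ones at most [4], in units of [a^-2], which
    the proof writes as [1 + 3 * (i == j)]. *)
Lemma integral_pos_sum_sqr n : \int[P]_w (pos_sum n w ^+ 2)%:E <=
  ((n%:R ^+ 2 + 3 * n%:R) * (a^-1 * a^-1))%:E.
Proof.
have sqrE w : ((pos_sum n w ^+ 2)%:E =
    \sum_(i < n) \sum_(j < n) (pos_wait i w * pos_wait j w)%:E)%E.
  under eq_bigr do rewrite sumEFin.
  rewrite sumEFin expr2 {1}/pos_sum mulr_suml; congr EFin.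
  by apply: eq_bigr => i _; rewrite /pos_sum mulr_sumr.
have mij (i j : nat) : measurable_fun setT (fun w => (pos_wait i w * pos_wait j w)%:E).
  by apply/measurable_EFinP; apply: measurable_funM; exact: measurable_pos_wait.
have ij0 (i j : nat) w : 0 <= (pos_wait i w * pos_wait j w)%:E.
  by rewrite lee_fin mulr_ge0// pos_wait_ge0.
under eq_integral do rewrite sqrE.
rewrite ge0_integral_sum//; last 2 first.
- by move=> i; apply: emeasurable_sum => j.
- by move=> i w _; apply: sume_ge0 => j _; exact: ij0.
under eq_bigr => i _.
  rewrite ge0_integral_sum//; over.
apply: (@le_trans _ _ (\sum_(i < n) \sum_(j < n)
   ((1 + 3 * (i == j)%:R) * (a^-1 * a^-1))%:E)).
  apply: lee_sum => i _; apply: lee_sum => j _.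
  have [->|ij] := eqVneq i j.
    by rewrite (_ : 1 + 3 * true%:R = 4)%R; [exact: integral_pos_wait_sqr|rewrite /=; ring].
  by rewrite mulr0 addr0 mul1r integral_pos_wait_mul.
under eq_bigr do rewrite sumEFin.
rewrite sumEFin lee_fin; under eq_bigr do rewrite -mulr_suml.
rewrite -mulr_suml ler_wpM2r ?mulr_ge0 ?invr_ge0 ?(ltW a_gt0)//.
under eq_bigr => i _.
  rewrite big_split/= sumr_const card_ord -mulr_sumr (bigD1 i)//= eqxx big1; last first.
    by move=> j ji; rewrite eq_sym (negbTE ji).
  over.
rewrite sumr_const card_ord; rewrite le_eqVlt.
by apply/orP; left; apply/eqP; rewrite -[LHS]mulr_natr /=; ring.
Qed.

(** The cross term is added to the variance side, so that only nonnegative functions are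
    integrated. *)
Lemma integral_pos_sum_var n :
  \int[P]_w ((pos_sum n w - n%:R / a) ^+ 2)%:E <= (3 * n%:R * (a^-1 * a^-1))%:E.
Proof.
set m := (n%:R / a)%R; have m0 : (0 <= m)%R by rewrite divr_ge0// ltW.
have mS := measurable_pos_sum n.
have mV : measurable_fun setT (fun w => ((pos_sum n w - m) ^+ 2)%:E).
  by apply/measurable_EFinP; apply: measurable_funX; exact: measurable_funB.
have mSE : measurable_fun setT (fun w => (pos_sum n w)%:E) by exact/measurable_EFinP.
have mSm : measurable_fun setT (fun w => (2 * m)%:E * (pos_sum n w)%:E).
  exact: measurable_funeM.
have mS2 : measurable_fun setT (fun w => (pos_sum n w ^+ 2)%:E).
  by apply/measurable_EFinP; exact: measurable_funX.
have S0 w : 0 <= (pos_sum n w)%:E by rewrite lee_fin pos_sum_ge0.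
have m20 : (0 <= 2 * m)%R by rewrite mulr_ge0.
have Sm0 w : 0 <= (2 * m)%:E * (pos_sum n w)%:E by rewrite mule_ge0.
have sq0 (x : R) : 0 <= (x ^+ 2)%:E by rewrite lee_fin sqr_ge0.
have : \int[P]_w (((pos_sum n w - m) ^+ 2)%:E + (2 * m)%:E * (pos_sum n w)%:E) =
       \int[P]_w ((pos_sum n w ^+ 2)%:E + (m ^+ 2)%:E).
  by apply: eq_integral => w _; rewrite -EFinM -!EFinD; congr EFin; ring.
rewrite ge0_integralD// ge0_integralD// ge0_integralZl_EFin//.
rewrite integral_pos_sum integral_cst//= probability_setT mule1 -/m -EFinM.
have := integral_pos_sum_sqr n; move: (\int[P]_w (pos_sum n w ^+ 2)%:E) => J.
move: (\int[P]_w _) => V JJ VJ.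
have : V + (2 * m * m)%:E <= ((n%:R ^+ 2 + 3 * n%:R) * (a^-1 * a^-1))%:E + (m ^+ 2)%:E.
  by rewrite VJ leeD2r.
rewrite -leeBrDr// => /le_trans; apply; rewrite -!EFinD lee_fin /m.
by rewrite le_eqVlt; apply/orP; left; apply/eqP; field; rewrite gt_eqF.
Qed.

Lemma pos_sum_deviation n eps : (0 < eps)%R ->
  P [set w | (eps <= `|pos_sum n w - n%:R / a|)%R] <=
  (eps ^- 2 * (3 * n%:R * (a^-1 * a^-1)))%:E.
Proof.
move=> e0; set Z := (fun w => pos_sum n w - n%:R / a)%R.
have mZ : measurable_fun setT Z by apply: measurable_funB => //; exact: measurable_pos_sum.
pose ZX : {RV P >-> R} := mfun_Sub (mem_set mZ : Z \in mfun).
have := @markov _ _ _ P ZX (fun x => x ^+ 2)%R eps e0.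
move=> /(_ (measurable_funX 2 (@measurable_id _ _ _))) /(_ (fun r _ => sqr_ge0 r)) H.
have {H} : (eps ^+ 2)%:E * P [set w | (eps <= `|Z w|)%R] <=
    \int[P]_w ((pos_sum n w - n%:R / a) ^+ 2)%:E.
  apply: le_trans (H _) _; first by move=> x y; rewrite !nnegrE => x0 y0; rewrite ler_sqr.
  rewrite expectation.unlock; under eq_integral do rewrite /= real_normK ?num_real//.
  by [].
move=> /le_trans /(_ (integral_pos_sum_var n)).
by rewrite -lee_pdivlMl ?exprn_gt0// -EFinM.
Qed.

(* Monotonicity of the partial sums reduces the supremum over [i <= n] to a
   number of grid points independent of [n], each controlled by Chebyshev. *)
Lemma pos_sum_uniform_deviation (eps delta : R) : (0 < eps)%R -> (0 < delta)%R ->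
  exists n0 : nat, forall n, (n0 <= n)%N -> exists B : set T,
    [/\ measurable B, P B <= delta%:E & forall w, ~ B w -> forall i, (i <= n)%N ->
      (`|pos_sum i w - i%:R / a| <= eps * n%:R)%R].
Proof.
move=> e0 d0.
(* Makes one grid cell, of length [L <= 2 * n / m], change the mean by at most [eps * n / 2]. *)
pose m := (Num.truncn (4 / (a * eps))).+1.
have ma : (4 / (a * eps) <= m%:R)%R by apply/ltW; exact: truncnS_gt.
(* [C / n] is the sum of [m.+2] Chebyshev bounds with threshold [eps * n / 2] at indices up to
   [m.+2 * (2 * n)]. *)
pose C : R := (24 * (m.+2)%:R * (m.+2)%:R / (a * eps) ^+ 2)%R.
exists (m + (Num.truncn (C / delta)).+1)%N => n n0n.
have mn : (m <= n)%N by apply: leq_trans n0n; rewrite leq_addr.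
have n0 : (0 < n%:R :> R)%R by rewrite ltr0n; apply: leq_trans mn.
have Cn : (C <= delta * n%:R)%R.
  rewrite mulrC -ler_pdivrMr//; apply/ltW/(lt_le_trans (truncnS_gt _)).
  by rewrite ler_nat; apply: leq_trans n0n; rewrite leq_addl.
pose L := (n %/ m).+1.
have nmL : (n < m * L)%N by rewrite mulnC; exact: ltn_ceil.
have L2n : (L <= n + n)%N.
  have := leq_div n m; have : (0 < n)%N by apply: leq_trans mn.
  by rewrite /L; lia.
have Lm : (L%:R * m%:R <= 2 * n%:R :> R)%R.
  rewrite -natrM -[2%R]/(2%:R) -natrM ler_nat /L mulSn.
  by have := leq_trunc_div n m; lia.
pose B q := [set w | (eps * n%:R / 2 <= `|pos_sum (q * L) w - (q * L)%:R / a|)%R].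
have en0 : (0 < eps * n%:R / 2)%R by rewrite divr_gt0// mulr_gt0.
have mB q : measurable (B q).
  have : measurable_fun setT (fun w => (eps * n%:R / 2 <= `|pos_sum (q * L) w - (q * L)%:R / a|)%R).
    apply: measurable_fun_ler => //; apply: measurableT_comp => //.
    by apply: measurable_funB => //; exact: measurable_pos_sum.
  by move=> /(_ measurableT [set true]); rewrite setTI; exact.
exists (\big[setU/set0]_(q < m.+2) B q); split.
- by apply: bigsetU_measurable.
- apply: le_trans (Boole_inequality P (fun q _ => mB q)) _.
  apply: (@le_trans _ _ (\sum_(q < m.+2) (C / m.+2%:R / n%:R)%:E)).
    apply: lee_sum => q _; apply: le_trans (pos_sum_deviation _ en0) _.
    rewrite lee_fin.
    have qm : ((q * L)%:R <= m.+2%:R * (2 * n%:R) :> R)%R.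
      rewrite natrM ler_pM// ?ler_nat; first by rewrite ltnW.
      by rewrite -[2%R]/(2%:R) -natrM ler_nat; lia.
    apply: (@le_trans _ _ ((eps * n%:R / 2) ^- 2 *
        (3 * (m.+2%:R * (2 * n%:R)) * (a^-1 * a^-1)))%R).
      apply: ler_wpM2l; first by rewrite invr_ge0 exprn_ge0// ltW.
      by apply: ler_wpM2r; [rewrite mulr_ge0// invr_ge0 ltW|rewrite ler_pM2l].
    rewrite le_eqVlt; apply/orP; left; apply/eqP; rewrite /C.
    by field; rewrite !gt_eqF//=.
  rewrite sumEFin sumr_const card_ord lee_fin -[leLHS]mulr_natr.
  rewrite mulrAC divfK ?pnatr_eq0// ler_pdivrMr//.
- move=> w nB i iN; pose q := (i %/ L)%N.
  have qm : (q < m)%N by rewrite ltn_divLR//; apply: leq_ltn_trans nmL.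
  have good k : (k < m.+2)%N -> (`|pos_sum (k * L) w - (k * L)%:R / a| < eps * n%:R / 2)%R.
    move=> km; rewrite ltNge; apply/negP => Bk; apply: nB.
    by rewrite -bigcup_mkord; exists k.
  (* Sandwich between adjacent grid points: half of [eps * n] is their deviation, half the change of
     the mean over the cell. *)
  have := good q (ltnW (leqW qm)); have := good q.+1 (leqW qm).
  have qi : (q * L <= i)%N by exact: leq_trunc_div.
  have iq : (i <= q.+1 * L)%N by apply/ltnW; exact: ltn_ceil.
  have := pos_sum_mono w qi; have := pos_sum_mono w iq.
  have ai : (0 < a^-1)%R by rewrite invr_gt0.
  have qia : ((q * L)%:R / a <= i%:R / a :> R)%R by rewrite ler_pM2r// ler_nat.
  have iqa : (i%:R / a <= (q * L)%:R / a + L%:R / a :> R)%R.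
    by rewrite -mulrDl ler_pM2r// -natrD ler_nat addnC -mulSn.
  have La : (L%:R / a <= eps * n%:R / 2)%R.
    have : (4 / (a * eps) * L%:R <= 2 * n%:R)%R.
      by apply: le_trans Lm; rewrite mulrC ler_wpM2l.
    have -> : (4 / (a * eps) * L%:R = 4 / eps * (L%:R / a))%R.
      by field; rewrite !gt_eqF.
    rewrite -ler_pdivlMl ?divr_gt0// => /le_trans; apply.
    by rewrite le_eqVlt; apply/orP; left; apply/eqP; field; rewrite gt_eqF.
  rewrite !mulSn natrD mulrDl !ltr_norml => ? ? /andP[? ?] /andP[? ?].
  by rewrite ler_norml; apply/andP; split; lra.
Qed.

(** The tail formula at [0] gives [X n > 0] almost surely; then take a countable union. *)
Lemma negative_wait_null : exists2 B : set T, measurable B /\ P B = 0 &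
  forall w, ~ B w -> forall n, (0 <= X n w)%R.
Proof.
have mA n : measurable (~` [set w | (0 < X n w)%R]).
  by apply: measurableC; exact: measurable_above.
exists (\bigcup_n ~` [set w | (0 < X n w)%R]).
  split; first exact: bigcupT_measurable.
  apply/eqP; rewrite eq_le measure_ge0 andbT.
  apply: le_trans (generalized_Boole_inequality _ mA (bigcupT_measurable _ mA)) _.
  rewrite eseries0// => n _ _.
  apply: etrans (probability_setC P (measurable_above 0%R (@measurable_funPT _ _ _ _ (X n)))) _.
  by rewrite (X_exp n (lexx 0%R)) mulr0 oppr0 expR0 subee.
move=> w nB n; rewrite leNgt; apply/negP => Xn; apply: nB; exists n => //=.
by apply/negP; rewrite -leNgt ltW.
Qed.

Lemma wait_sum_uniform_deviation (eps delta : R) : (0 < eps)%R -> (0 < delta)%R ->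
  exists n0 : nat, forall n, (n0 <= n)%N -> exists B : set T,
    [/\ measurable B, P B <= delta%:E & forall w, ~ B w ->
      (forall k, 0 <= X k w)%R /\ forall i, (i <= n)%N ->
      (`|\sum_(k < i) X k w - i%:R / a| <= eps * n%:R)%R].
Proof.
move=> e0 d0; have [n0 H] := pos_sum_uniform_deviation e0 d0.
have [B0 [mB0 PB0] nB0] := negative_wait_null.
exists n0 => n /H[B [mB PB nB]]; exists (B `|` B0); split.
- exact: measurableU.
- have PB0' : P B0 <= 0 by rewrite PB0.
  apply: le_trans (measureU2 _ mB mB0) _.
  by apply: le_trans (leeD PB PB0') _; rewrite adde0.
- move=> w /not_orP[/nB Bw /nB0 B0w]; split => // i iN.
  rewrite (eq_bigr (fun k : 'I_i => pos_wait k w)); first exact: Bw.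
  by move=> k _; rewrite /pos_wait max_l.
Qed.

End ExponentialMoments.

(** * Union bound over the flows and convergence in probability *)

Lemma measure_bigsetU_le d (T : measurableType d) (R : realType)
    (mu : {measure set T -> \bar R}) (I : Type) (s : seq I) (A : I -> set T) :
  (forall i, measurable (A i)) ->
  (mu (\big[setU/set0]_(i <- s) A i) <= \sum_(i <- s) mu (A i))%E.
Proof.
move=> mA; elim: s => [|i s IH]; first by rewrite !big_nil measure0.
rewrite !big_cons; apply: le_trans (measureU2 _ _ _) _ => //.
  exact: bigsetU_measurable.
exact: leeD2l.
Qed.

Lemma mutually_independent_tails d (Omega : measurableType d) (R : realType)
    (P : probability Omega R) (I : eqType) (X : I -> Omega -> R) i j (s r : R) :
  mutually_independent P X -> i != j ->
  P [set w | s < X i w /\ r < X j w] =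
  (P [set w | (s < X i w)%R] * P [set w | (r < X j w)%R])%E.
Proof.
move=> /(_ [:: i; j] (fun k => if k == i then `]s, +oo[%classic else `]r, +oo[%classic)) H ij.
have tailE k (u : R) : X k @^-1` `]u, +oo[ = [set w | u < X k w].
  by apply/seteqP; split => w /=; rewrite in_itv/= andbT.
move: H; rewrite !big_cons !big_nil eqxx [j == i]eq_sym (negbTE ij) !tailE setIT mule1.
by apply; [rewrite /= inE ij|move=> k; case: eqP => _; exact: measurable_itv].
Qed.

Theorem theorem4 (R : realType) (d : measure_display) (Omega : measurableType d)
  (P : probability Omega R) (N : nat) (lam beta : nat -> R) (x0 : nat -> int)
  (E : flow N -> nat -> {RV P >-> R}) :
  (forall i, (i < N)%N -> 0 < lam i) ->
  (forall i j, (i < N)%N -> (j < N)%N -> i != j -> lam i != lam j) ->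
  (forall j, (j.+1 < N)%N -> 0 < beta j) ->
  (forall f n, exponential_rv P (flow_rate lam beta f) (E f n)) ->
  mutually_independent P (fun p : flow N * nat => (E p.1 p.2 : Omega -> R)) ->
  (forall v : R, (#|[set i : 'I_N | ell lam i == v]| <= 3)%N) ->
  forall j, (j < N)%N ->
  forall eps delta : R, 0 < eps -> 0 < delta ->
  exists T : R, forall t : R, T <= t ->
    (P [set w | ~ exists v : int,
          position_at x0 (fun f n => E f n w) t j v /\
          (`| v%:~R / t - ell lam j | <= eps)%R] <= delta%:E)%E.
Proof.
move=> lam0 _ beta0 Eexp Eind _ j jN eps delta eps0 delta0.
have rate0 (f : flow N) : 0 < flow_rate lam beta f by exact: flow_rate_gt0.
have [C C0 HC] := speed_error x0 lam0 beta0 jN.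
pose Rm := \sum_(f : flow N) flow_rate lam beta f.
have Rm_ge (f : flow N) : flow_rate lam beta f <= Rm.
  by rewrite /Rm (bigD1 f)//= lerDl; apply: sumr_ge0 => g _; exact/ltW.
have Rm0 : 0 < Rm by exact: lt_le_trans (Rm_ge (inl (Ordinal jN))).
(* With time error [eta0 * t], the part of the speed error proportional to [t] is at most
   [eps * t / 2]. *)
pose eta0 := eps / (2 * (C + 1)).
have C1 : 0 < C + 1 by exact: ltr_wpDl.
have eta00 : 0 < eta0 by rewrite divr_gt0// mulr_gt0.
(* More than [c * t] points of any flow nominally last beyond [t + eta0 * t]. *)
pose c := Rm * (1 + eta0).
have c0 : 0 < c by rewrite mulr_gt0// addr_gt0.
(* Since [M <= (c + 1) * t], the deviation [e * M] is at most [eta0 * t]. *)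
pose e := eta0 / (c + 1).
have e0 : 0 < e by rewrite divr_gt0// addr_gt0.
pose dl := delta / #|{: flow N}|%:R.
have F0 : (0 < #|{: flow N}|)%N by apply/card_gt0P; exists (inl (Ordinal jN)).
have dl0 : 0 < dl by rewrite divr_gt0// ltr0n.
have dev (f : flow N) : exists n0 : nat, forall n, (n0 <= n)%N -> exists B : set Omega,
    [/\ measurable B, (P B <= dl%:E)%E & forall w, ~ B w ->
      (forall k, 0 <= E f k w) /\ forall i, (i <= n)%N ->
      `|\sum_(k < i) E f k w - i%:R / flow_rate lam beta f| <= e * n%:R].
  apply: (wait_sum_uniform_deviation (rate0 f) (Eexp f) _ e0 dl0) => i k s r ik.
  apply: (mutually_independent_tails (i := (f, i)) (j := (f, k)) s r Eind).
  by rewrite xpair_eqE eqxx.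
pose n0 f := projT1 (cid (dev f)); pose M0 := (\sum_f n0 f)%N.
(* The three terms give [1 <= t], absorption of the constant error into [eps * t / 2], and [M]
   beyond the threshold of every flow. *)
exists (1 + 2 * (C + 1) / eps + M0%:R / c) => t Tt.
have q1 : 0 <= 2 * (C + 1) / eps by rewrite divr_ge0// ?mulr_ge0// ltW.
have q2 : 0 <= M0%:R / c by rewrite divr_ge0// ltW.
have t1 : 1 <= t by lra.
have t0 : 0 < t by lra.
have tC : 2 * (C + 1) <= eps * t by rewrite [leRHS]mulrC -ler_pdivrMr//; lra.
have tM0 : M0%:R <= c * t by rewrite [leRHS]mulrC -ler_pdivrMr//; lra.
pose M := (Num.truncn (c * t)).+1.
have cM : c * t < M%:R by exact: truncnS_gt.
have Mc : M%:R <= (c + 1) * t.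
  have /truncn_itv/andP[+ _] : 0 <= c * t by rewrite mulr_ge0// ltW.
  by rewrite /M -natr1; lra.
have /choice[B HB] (f : flow N) : exists B : set Omega,
    [/\ measurable B, (P B <= dl%:E)%E & forall w, ~ B w ->
      (forall k, 0 <= E f k w) /\ forall i, (i <= M)%N ->
      `|\sum_(k < i) E f k w - i%:R / flow_rate lam beta f| <= e * M%:R].
  apply: (projT2 (cid (dev f))); rewrite -(ler_nat R).
  apply: le_trans (ltW cM); apply: le_trans tM0.
  by rewrite ler_nat /M0 (bigD1 f)//= leq_addr.
have mB f : measurable (B f) by have [] := HB f.
set A := [set w | _].
have mA : measurable A.
  have -> : A = ~` [set w | exists v : int, position_at x0 (fun f n => E f n w) t j v /\
      `|v%:~R / t - ell lam j| <= eps] by [].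
  apply: measurableC; apply: measurable_position_at => f n.
  exact: measurable_funPT.
apply: (@le_trans _ _ (P (\big[setU/set0]_(f : flow N) B f))).
  apply: le_measure; rewrite ?inE//; first exact: bigsetU_measurable.
  (* Outside all the exceptional sets [B f], [speed_error] applies with time error [eta0 * t]. *)
  move=> w Aw; apply: contrapT => nB; apply: Aw.
  have {}nB f : ~ B f w.
    by move=> Bf; apply: nB; rewrite -bigcup_pred; exists f.
  have [|||f|f n nM|v [pv vC]] := HC (fun f n => E f n w) (eta0 * t) t M.
  - by move=> f n; have [_ _ /(_ w (nB f))[]] := HB f.
  - by rewrite mulr_ge0// ltW.
  - exact: ltW.
  - rewrite ltr_pdivlMr//; apply: le_lt_trans cM.
    rewrite /c [leRHS](_ : _ = (t + eta0 * t) * Rm); last by ring.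
    by rewrite ler_pM2l// addr_gt0// mulr_gt0.
  - have [_ _ /(_ w (nB f))[_ /(_ n nM) /le_trans]] := HB f; apply.
    apply: le_trans (ler_wpM2l (ltW e0) Mc) _.
    by rewrite /e mulrA divfK// gt_eqF// addr_gt0.
  exists v; split => //.
  have -> : v%:~R / t - ell lam j = (v%:~R - ell lam j * t) / t.
    by field; rewrite gt_eqF.
  rewrite normrM normfV (gtr0_norm t0) ler_pdivrMr//; apply: le_trans vC _.
  have : (C + 1) * (eta0 * t) = eps * t / 2.
    by rewrite /eta0; field; rewrite gt_eqF.
  have et0 : 0 <= eta0 * t by rewrite mulr_ge0// ltW.
  by lra.
apply: le_trans (measure_bigsetU_le _ _ mB) _.
apply: (@le_trans _ _ (\sum_(f : flow N) dl%:E)%E).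
  by apply: lee_sum => f _; have [] := HB f.
by rewrite sumEFin sumr_const lee_fin -[leLHS]mulr_natr /dl divfK// pnatr_eq0 -lt0n.
Qed.
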